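(* Let $\mathcal Y_3\subset\mathbb R^2$ be three non-collinear points and let $X_1,X_2\stackrel{iid}{\sim}\mathcal U(T(\mathcal Y_3))$. For $r\in[1,\infty]$ let $p(r)$ be the mean of the relative arc density of the proportional-edge proximity catch digraph with parameter $r$, and let $p_{\text{and}}(r)$ and $p_{\text{or}}(r)$ be the means of the relative edge densities of its reflexivity graph and its underlying graph, i.e. $$p_{\text{and}}(r)=P\bigl(X_2\in N^r_{PE}(X_1)\cap\Gamma^r_1(X_1)\bigr),\quad p(r)=P\bigl(X_2\in N^r_{PE}(X_1)\bigr),\quad p_{\text{or}}(r)=P\bigl(X_2\in N^r_{PE}(X_1)\cup\Gamma^r_1(X_1)\bigr).$$ Then $p_{\text{and}}(r)<p(r)<p_{\text{or}}(r)$ for all $r\in[1,\infty)$. Furthermore, for $r=\infty$, $p_{\text{and}}(r)=p(r)=p_{\text{or}}(r)=1$.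
   Context: $T(\mathcal Y_3)$ is the closed triangle with vertices $\mathcal Y_3=\{y_1,y_2,y_3\}$ and $\mathcal U(T(\mathcal Y_3))$ the uniform distribution on it. The vertex regions $R(y_1),R(y_2),R(y_3)$ (with $y_i\in R(y_i)$) partition $T(\mathcal Y_3)$ using the segments from its center of mass to its edge midpoints. For $x\in T(\mathcal Y_3)\setminus\mathcal Y_3$, let $v(x)$ be the vertex whose region contains $x$ (chosen arbitrarily on boundaries of regions), $e(x)$ the edge opposite $v(x)$, and $\ell(v(x),x)$ the line through $x$ parallel to $e(x)$; $d$ is Euclidean distance. For $r\in[1,\infty)$ let $\ell_r(v(x),x)$ be the line parallel to $e(x)$ with $d(v(x),\ell_r(v(x),x))=r\,d(v(x),\ell(v(x),x))$ and $d(\ell(v(x),x),\ell_r(v(x),x))<d(v(x),\ell_r(v(x),x))$, and let $T_r(x)$ be the triangle similar to and with the same orientation as $T(\mathcal Y_3)$ having $v(x)$ as a vertex and its opposite edge on $\ell_r(v(x),x)$. The proportional-edge proximity region is $N^r_{PE}(x)=T_r(x)\cap T(\mathcal Y_3)$; $N^\infty_{PE}(x)=T(\mathcal Y_3)$ for $x\in T(\mathcal Y_3)\setminus\mathcal Y_3$; and $N^r_{PE}(x)=\{x\}$ for $x\in\mathcal Y_3$. Put $\Gamma^r_1(x)=\{z\in T(\mathcal Y_3): x\in N^r_{PE}(z)\}$. For points $X_1,\ldots,X_n$ the proportional-edge PCD has an arc $(X_i,X_j)$, $i\ne j$, iff $X_j\in N^r_{PE}(X_i)$; its relative arc density is (number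 of arcs)$/(n(n-1))$. The reflexivity (underlying) graph has edge $X_iX_j$ iff both (at least one) of $(X_i,X_j),(X_j,X_i)$ are arcs (is an arc); relative edge density is (number of edges)$/\binom n2$. *)

(* Defs.v *)
From mathcomp Require Import all_boot all_order all_algebra.
From mathcomp Require Import all_classical all_reals all_analysis.

Set Implicit Arguments.
Unset Strict Implicit.
Unset Printing Implicit Defensive.
Import Order.TTheory GRing.Theory Num.Theory.
Import numFieldNormedType.Exports.

Local Open Scope classical_set_scope.
Local Open Scope ring_scope.

Section geometry.
Context {R : realType}.

(* The library's norm on R * R is the sup norm, hence an explicit Euclidean
   distance. *)
Definition edist (p q : R * R) : R :=
  Num.sqrt ((p.1 - q.1) ^+ 2 + (p.2 - q.2) ^+ 2).

Definition set_dist (A B : set (R * R)) : R :=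
  inf [set edist a b | a in A & b in B].

Definition line (p u : R * R) : set (R * R) := [set p + t *: u | t in [set: R]].

Definition hull (I : finType) (w : I -> R * R) : set (R * R) :=
  [set z | exists a : I -> R,
     [/\ forall i, 0 <= a i, \sum_i a i = 1 & z = \sum_i a i *: w i]].

(* A triangle is given by its vertices w 0, w 1, w 2; the indices are taken
   modulo 3, so that i + 1 and i - 1 are the two indices different from i. *)
Definition triangle (w : 'I_3 -> R * R) : set (R * R) := hull w.

Definition collinear (w : 'I_3 -> R * R) : Prop :=
  exists p u, u != 0 /\ forall i, line p u (w i).

Definition opp_edge (w : 'I_3 -> R * R) (i : 'I_3) : set (R * R) :=
  hull (fun b : bool => if b then w (i + 1) else w (i - 1)).

Definition opp_dir (w : 'I_3 -> R * R) (i : 'I_3) : R * R :=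
  w (i + 1) - w (i - 1).

Definition parallel_opp (w : 'I_3 -> R * R) (i : 'I_3) (L : set (R * R)) : Prop :=
  exists p, L = line p (opp_dir w i).

(* "Similar with the same orientation": the image under z |-> k z + b, k > 0. *)
Definition same_orientation_similar (w' w : 'I_3 -> R * R) : Prop :=
  exists k b, 0 < k /\ forall i, w' i = k *: w i + b.

Definition midpoint (p q : R * R) : R * R := 2^-1 *: (p + q).

Definition center_of_mass (w : 'I_3 -> R * R) : R * R := 3^-1 *: \sum_i w i.

(* The quadrilateral cut out around w i by the segments from the center of mass
   to the midpoints of the two edges at w i: its corners are the center of mass,
   those two midpoints, and w i = midpoint (w i) (w i). *)
Definition vertex_region (w : 'I_3 -> R * R) (i : 'I_3) : set (R * R) :=
  hull (fun o : option 'I_3 =>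
          if o is Some j then midpoint (w i) (w j) else center_of_mass w).

(* v x is the index of the vertex v(x); it is left unconstrained off the
   triangle and at the vertices, and is arbitrary on region boundaries. *)
Definition region_choice (y : 'I_3 -> R * R) (v : R * R -> 'I_3) : Prop :=
  forall x, triangle y x -> (forall i, x <> y i) -> vertex_region y (v x) x.

Section proximity.
Variables (y : 'I_3 -> R * R) (v : R * R -> 'I_3).

Definition ell (x : R * R) : set (R * R) := line x (opp_dir y (v x)).

Definition is_ell_r (r : R) (x : R * R) (L : set (R * R)) : Prop :=
  let vx := [set y (v x)] in
  [/\ parallel_opp y (v x) L,
      set_dist vx L = r * set_dist vx (ell x) &
      set_dist (ell x) L < set_dist vx L].

Definition T_r (r : R) (x : R * R) : set (R * R) :=
  [set z | exists (L : set (R * R)) (w : 'I_3 -> R * R),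
     [/\ is_ell_r r x L, same_orientation_similar w y,
         exists i, w i = y (v x) /\ opp_edge w i `<=` L & triangle w z]].

(* Defined for x in the triangle; the value off the triangle is irrelevant. *)
Definition N_PE (r : \bar R) (x : R * R) : set (R * R) :=
  if `[< exists i, x = y i >] then [set x]
  else if `[< triangle y x >] then
    match r with
    | EFin r => T_r r x `&` triangle y
    | +oo%E => triangle y
    | -oo%E => set0
    end
  else set0.

Definition Gamma1 (r : \bar R) (x : R * R) : set (R * R) :=
  [set z | triangle y z /\ N_PE r z x].

End proximity.
End geometry.

Section graphs.
Context {R : realType} (n : nat).

Definition pcd_arc (N : R * R -> set (R * R)) (x : 'I_n -> R * R) : rel 'I_n :=
  fun i j => (i != j) && `[< N (x i) (x j) >].

Definition reflexivity_graph (e : rel 'I_n) : rel 'I_n :=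
  fun i j => e i j && e j i.

Definition underlying_graph (e : rel 'I_n) : rel 'I_n :=
  fun i j => e i j || e j i.

Definition arc_density (e : rel 'I_n) : R :=
  #|[pred a : 'I_n * 'I_n | e a.1 a.2]|%:R / (n * (n - 1))%:R.

(* For a symmetric e; an edge {i, j} is counted once, as the pair with i < j. *)
Definition edge_density (e : rel 'I_n) : R :=
  #|[pred a : 'I_n * 'I_n | (a.1 < a.2)%N && e a.1 a.2]|%:R / 'C(n, 2)%:R.

End graphs.

Section sample.
Context {R : realType} {d : measure_display} {Omega : measurableType d}.
Variable P : probability Omega R.

Definition lebesgue2 : set (R * R) -> \bar R :=
  (@lebesgue_measure R \x @lebesgue_measure R)%E.

Definition uniform_on (T : set (R * R)) (X : Omega -> R * R) : Prop :=
  forall A : set (R * R), measurable A ->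
    P (X @^-1` A) = (lebesgue2 (A `&` T) / lebesgue2 T)%E.

Definition mutually_independent (n : nat) (X : 'I_n -> Omega -> R * R) : Prop :=
  forall A : 'I_n -> set (R * R), (forall i, measurable (A i)) ->
    P (\bigcap_(i in [set: 'I_n]) (X i @^-1` A i)) =
    (\prod_(i < n) P (X i @^-1` A i))%E.

Section means.
Variables (y : 'I_3 -> R * R) (v : R * R -> 'I_3) (n : nat).
Variable X : 'I_n -> Omega -> R * R.

Definition pe_pcd (r : \bar R) (w : Omega) : rel 'I_n :=
  pcd_arc (N_PE y v r) (fun i => X i w).

Definition p_arc (r : \bar R) : \bar R :=
  'E_P[fun w => arc_density (pe_pcd r w)].

Definition p_and (r : \bar R) : \bar R :=
  'E_P[fun w => edge_density (reflexivity_graph (pe_pcd r w))].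

Definition p_or (r : \bar R) : \bar R :=
  'E_P[fun w => edge_density (underlying_graph (pe_pcd r w))].

End means.
End sample.

(* Main.v *)
Require Import Defs.
From mathcomp Require Import all_boot all_order all_algebra.
From mathcomp Require Import all_classical all_reals all_analysis.
From mathcomp Require Import measurable_realfun ring lra.
Import numFieldNormedType.Exports.
Import Order.TTheory GRing.Theory Num.Theory.

Local Open Scope classical_set_scope.
Local Open Scope ring_scope.

(** Everything is read off in barycentric coordinates [bary y k] with respect to
    the triangle. The number [1 - bary y k z] is the distance from the vertex
    [y k] to the parallel through [z] to the opposite edge, measured in units of
    the altitude; hence for a non-vertex [x] with [v x = k] the proximity region
    is the set of the points [z] of the triangle with
    [1 - bary y k z <= r * (1 - bary y k x)] ([N_PE_real]), and the vertex
    region of [y k] only has points whose largest coordinate is the [k]-th one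
    ([vertex_region_bary]).

    The ties between two coordinates, the vertices and the outside of the
    triangle have probability zero ([exceptional_null]). Off that set the choice
    [v] is forced, so that the arc relation is a fixed Borel relation applied to
    a pair of points ([N_PE_dominance_arc]). By independence every pair of
    distinct sample points has the same product law ([pair_law]), therefore
    every pair realizes a given pattern of arcs with the same probability
    ([arc_pattern_law]), and the mean of a density, which is the frequency of a
    pattern among the pairs, is this common probability ([mean_arcs],
    [mean_edges]).

    For finite [r] the two inequalities are strict because an arc can fail to be
    reciprocated on an event of positive probability: if [x] and [z] both lie in
    the region of the vertex [y 0], at relative distances between 1/4 and 1/2
    and below 1/(4r) from it, then [z] is in the region of [x] but [x] is not in
    that of [z] ([slab_arc]). Such pairs form a product of two nonempty open
    sets ([slab_pair_gt0]). For infinite [r], any two points of the triangle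
    other than its vertices are joined by arcs in both directions
    ([arc_event_pinfty]). *)

(** * Indices modulo 3 *)

Lemma ord3_succ2 (k : 'I_3) : k + 1 + 1 = k - 1.
Proof. by apply/val_inj; case: k => -[|[|[|]]]. Qed.

Lemma ord3_pred2 (k : 'I_3) : k - 1 - 1 = k + 1.
Proof. by apply/val_inj; case: k => -[|[|[|]]]. Qed.

Lemma ord3_11 : 1 + 1 = -1 :> 'I_3. Proof. exact/val_inj. Qed.

Lemma ord3_N1N1 : -1 - 1 = 1 :> 'I_3. Proof. exact/val_inj. Qed.

Lemma ord3_neqS (k : 'I_3) : k + 1 == k = false.
Proof. by case: k => -[|[|[|]]]. Qed.

Lemma ord3_ind (k : 'I_3) (Q : 'I_3 -> Prop) :
  Q k -> Q (k + 1) -> Q (k - 1) -> forall j, Q j.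
Proof.
move=> Q0 Q1 Q2 j.
have /orP[/eqP->//|/orP[/eqP->//|/eqP->//]] :
  (j == k) || ((j == k + 1) || (j == k - 1)).
by case: k {Q0 Q1 Q2} => -[|[|[|]]] // ?; case: j => -[|[|[|]]].
Qed.

Lemma sum_ord3 {V : zmodType} (k : 'I_3) (F : 'I_3 -> V) :
  \sum_i F i = F k + F (k + 1) + F (k - 1).
Proof.
rewrite (reindex (fun i => k + i)) /=; last first.
  by exists (fun i => i - k) => i _; rewrite addrC ?addKr ?subrK.
rewrite !big_ord_recl big_ord0 !addr0 addrA.
by congr (F _ + F _ + F _); apply/val_inj; case: k => -[|[|[|]]].
Qed.

(** * Affine functions and convex hulls *)

Section geometry.
Set Implicit Arguments.
Unset Strict Implicit.
Context {R : realType}.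
Implicit Types (p q u z : R * R) (y : 'I_3 -> R * R).

Lemma eq_pair (p q : R * R) : p.1 = q.1 -> p.2 = q.2 -> p = q.
Proof. by case: p q => [? ?] [? ?] /= -> ->. Qed.

Definition affine (f : R * R -> R) :=
  exists a b c, forall z, f z = a * z.1 + b * z.2 + c.

Lemma affine_homothety f p q k :
  affine f -> f (p + k *: (q - p)) = f p + k * (f q - f p).
Proof.
by move=> [a [b [c fE]]]; rewrite !fE /= /GRing.scale /=; ring.
Qed.

Lemma affineB f g : affine f -> affine g -> affine (fun z => f z - g z).
Proof.
move=> [a [b [c fE]]] [a' [b' [c' gE]]].
by exists (a - a'), (b - b'), (c - c') => z; rewrite fE gE; ring.
Qed.

Lemma affine_cst k : affine (fun=> k).
Proof. by exists 0, 0, k => z; ring. Qed.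

Lemma affine_comb (I : finType) (a : I -> R) (w : I -> R * R) f :
  affine f -> \sum_i a i = 1 ->
  f (\sum_i a i *: w i) = \sum_i a i * f (w i).
Proof.
move=> [b [c [e fE]]] a1; rewrite fE.
rewrite (big_morph fst (id1 := 0) (op1 := +%R)) //.
rewrite (big_morph snd (id1 := 0) (op1 := +%R)) //=.
rewrite !mulr_sumr -[e]mulr1 -a1 mulr_sumr -!big_split /=.
by apply: eq_bigr => i _; rewrite fE; rewrite /GRing.scale /=; ring.
Qed.

(** All inclusions between polygons below reduce to this: an affine inequality
    propagates from the vertices to the whole hull. *)
Lemma hull_affine_ge0 (I : finType) (w : I -> R * R) f z :
  affine f -> (forall i, 0 <= f (w i)) -> hull w z -> 0 <= f z.
Proof.
move=> af f0 [a [a0 a1 ->]]; rewrite affine_comb //.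
by apply: sumr_ge0 => i _; rewrite mulr_ge0.
Qed.

Lemma hull_vertex (I : finType) (w : I -> R * R) i : hull w (w i).
Proof.
exists (fun j => (j == i)%:R); split.
- by move=> j; rewrite ler0n.
- by rewrite (bigD1 i) //= eqxx big1 ?addr0 // => j /negPf ->.
- rewrite (bigD1 i) //= eqxx scale1r big1 ?addr0 // => j /negPf ->.
  by rewrite scale0r.
Qed.

(** * Barycentric coordinates *)

Definition det (p q : R * R) : R := p.1 * q.2 - p.2 * q.1.

(** Twice the signed area of the triangle. *)
Definition orient y : R := det (y 1 - y 0) (y (-1) - y 0).

(** Cramer's formula: the ratio of the signed areas of the triangle in which
    [z] replaces the vertex [y k] and of the whole triangle. *)
Definition bary y (k : 'I_3) z : R :=
  det (y (k + 1) - z) (y (k - 1) - z) / orient y.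

Lemma orient_rot y k : det (y (k + 1) - y k) (y (k - 1) - y k) = orient y.
Proof.
rewrite /orient; elim/(ord3_ind 0) : k.
- by rewrite add0r sub0r.
- by rewrite add0r ord3_11 subrr /det/=; ring.
- by rewrite sub0r addNr ord3_N1N1 /det/=; ring.
Qed.

Lemma bary_affine y k : affine (bary y k).
Proof.
rewrite /bary; set D := orient y.
exists (((y (k + 1)).2 - (y (k - 1)).2) / D),
  (((y (k - 1)).1 - (y (k + 1)).1) / D), (det (y (k + 1)) (y (k - 1)) / D) => z.
by rewrite /det /=; ring.
Qed.

Lemma sqnorm_neq0 (u : R * R) : u != 0 -> u.1 ^+ 2 + u.2 ^+ 2 != 0.
Proof.
apply: contra_neq => /eqP; rewrite paddr_eq0 ?sqr_ge0 // !sqrf_eq0.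
by case: u => a b /= /andP[/eqP-> /eqP->].
Qed.

Lemma det_eq0_parallel (u w : R * R) :
  u != 0 -> det u w = 0 -> exists t : R, w = t *: u.
Proof.
case: u w => [a b] [c e] /sqnorm_neq0 /= uu; rewrite /det /= => D0.
exists ((a * c + b * e) / (a ^+ 2 + b ^+ 2)).
have uuK (r s : R) : (a ^+ 2 + b ^+ 2) * (r / (a ^+ 2 + b ^+ 2) * s) = r * s.
  by rewrite mulrA mulrCA divff // mulr1.
congr pair; rewrite /GRing.scale /=; apply: (mulfI uu); rewrite uuK.
  apply/eqP; rewrite -subr_eq0; apply/eqP.
  by transitivity (- b * (a * e - b * c)); [ring | rewrite D0 mulr0].
apply/eqP; rewrite -subr_eq0; apply/eqP.
by transitivity (a * (a * e - b * c)); [ring | rewrite D0 mulr0].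
Qed.

Lemma noncollinear_orient y : ~ collinear y -> orient y != 0.
Proof.
move=> ync; apply/eqP => D0; apply: ync.
suff [u [u0 [s sE] [t tE]]] : exists u : R * R, [/\ u != 0,
    exists s : R, y 1 - y 0 = s *: u & exists t : R, y (-1) - y 0 = t *: u].
  exists (y 0), u; split=> //; elim/(ord3_ind 0) => [||].
  - by exists 0 => //; rewrite scale0r addr0.
  - by exists s => //; rewrite -sE add0r addrC subrK.
  - by exists t => //; rewrite -tE sub0r addrC subrK.
have [y10|y10] := eqVneq (y 1 - y 0) 0; last first.
  exists (y 1 - y 0); split=> //; last exact: det_eq0_parallel.
  by exists 1; rewrite scale1r.
have [y20|y20] := eqVneq (y (-1) - y 0) 0.
  exists (1, 0); split; first by rewrite -subr_eq0 subr0 xpair_eqE oner_eq0.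
    by exists 0; rewrite y10 scale0r.
  by exists 0; rewrite y20 scale0r.
exists (y (-1) - y 0); split=> //.
  by exists 0; rewrite y10 scale0r.
by exists 1; rewrite scale1r.
Qed.

Section bary.
Variable y : 'I_3 -> R * R.
Hypothesis y0 : orient y != 0.

Lemma bary_vertex k j : bary y k (y j) = (j == k)%:R.
Proof.
rewrite /bary; elim/(ord3_ind k) : j.
- by rewrite eqxx orient_rot divff.
- rewrite (_ : det _ _ = 0) ?mul0r; last by rewrite /det /=; ring.
  by case: k => -[|[|[|]]].
- rewrite (_ : det _ _ = 0) ?mul0r; last by rewrite /det /=; ring.
  by case: k => -[|[|[|]]].
Qed.

Lemma sum_bary k z : bary y k z + bary y (k + 1) z + bary y (k - 1) z = 1.
Proof.
rewrite /bary subrK addrK ord3_succ2 ord3_pred2 -!mulrDl.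
rewrite -(orient_rot y k) (_ : _ + _ = det (y (k + 1) - y k) (y (k - 1) - y k)).
  by rewrite divff // orient_rot.
by rewrite /det /=; ring.
Qed.

(** The coordinates of Cramer's formula solve the linear system of which the
    determinant is [orient y]. *)
Lemma bary_decomp z : z = \sum_i bary y i z *: y i.
Proof.
rewrite (sum_ord3 0) /bary add0r sub0r subrr addNr ord3_11 ord3_N1N1.
move: y0; rewrite /orient /det /= => D0.
by apply: eq_pair; rewrite /= /GRing.scale /= /GRing.scale /=; field.
Qed.

Lemma triangleP z : triangle y z <-> forall k, 0 <= bary y k z.
Proof.
split=> [Tz k|bz].
  apply: hull_affine_ge0 Tz; first exact: bary_affine.
  by move=> i; rewrite bary_vertex ler0n.
exists (bary y ^~ z); split=> //; last exact: bary_decomp.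
by rewrite (sum_ord3 0) sum_bary.
Qed.

Lemma bary_inj z z' : (forall k, bary y k z = bary y k z') -> z = z'.
Proof.
move=> e; rewrite [z]bary_decomp [z']bary_decomp.
by apply: eq_bigr => i _; rewrite e.
Qed.

(** The inequality holds at the four corners of the region: there the [i]-th
    coordinate is 1, 1/2, 1/2 and 1/3, and it is nowhere smaller than another
    one. *)
Lemma vertex_region_bary i j z :
  vertex_region y i z -> bary y j z <= bary y i z.
Proof.
move=> Vz; rewrite -subr_ge0.
have af : affine (fun z => bary y i z - bary y j z).
  by apply: affineB; exact: bary_affine.
have av k : bary y i (y k) - bary y j (y k) = (k == i)%:R - (k == j)%:R.
  by rewrite !bary_vertex.
have [->|ij] := eqVneq i j; first by rewrite subrr.
apply: (hull_affine_ge0 af _ Vz) => -[k|].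
- rewrite /midpoint scalerDr.
  have [a [b [c fE]]] := af.
  have -> : forall p q,
      bary y i (2^-1 *: p + 2^-1 *: q) - bary y j (2^-1 *: p + 2^-1 *: q) =
      2^-1 * ((bary y i p - bary y j p) + (bary y i q - bary y j q)).
    by move=> p q; rewrite !fE /= /GRing.scale /= /GRing.scale /=; field.
  rewrite !av eqxx (negPf ij) subr0 mulr_ge0 ?invr_ge0 //.
  by case: (k == i); case: (k == j) => /=; lra.
- rewrite /center_of_mass scaler_sumr.
  rewrite (affine_comb (a := fun=> 3^-1) y af); last first.
    by rewrite sumr_const card_ord -[_ *+ _]mulr_natr; field.
  under eq_bigr => k _ do rewrite av.
  rewrite -mulr_sumr sumrB.
  have dirac l : \sum_k (k == l)%:R = 1 :> R.
    by rewrite (bigD1 l) //= eqxx big1 ?addr0 // => k /negPf ->.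
  by rewrite !dirac subrr mulr0.
Qed.

Lemma bary_le1 k z : triangle y z -> bary y k z <= 1.
Proof.
move/triangleP => b0; rewrite -(sum_bary k z) -addrA lerDl.
by rewrite addr_ge0.
Qed.

Lemma bary_eq1 k z : triangle y z -> bary y k z = 1 -> z = y k.
Proof.
move/triangleP => b0 b1; have := sum_bary k z; rewrite b1.
have p1 := b0 (k + 1); have m1 := b0 (k - 1) => S.
have p0 : bary y (k + 1) z = 0 by lra.
have m0 : bary y (k - 1) z = 0 by lra.
have [kp km] : k != k + 1 /\ k != k - 1 by case: (k) => -[|[|[|]]].
apply: bary_inj => j; rewrite bary_vertex.
by elim/(ord3_ind k): j; rewrite ?eqxx // ?(negPf kp) ?(negPf km).
Qed.

(** The left-hand side is, up to the length of the edge, the signed distance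
    from the vertex to the parallel to the opposite edge through [z]; it is thus
    proportional to [1 - bary y k z]. *)
Lemma det_opp_dir k z :
  det (y k - z) (opp_dir y k) = orient y * (1 - bary y k z).
Proof.
rewrite mulrBr mulr1 /bary mulrC mulrVK ?unitfE //.
by rewrite -(orient_rot y k) /opp_dir /det /=; ring.
Qed.

Lemma opp_dir_neq0 k : opp_dir y k != 0.
Proof.
apply: contraNneq y0 => /eqP; rewrite subr_eq0 => /eqP e.
by rewrite -(orient_rot y k) e /det; apply/eqP; ring.
Qed.

End bary.

(** * Distances to a line and the proximity regions *)

Definition norm2 (u : R * R) : R := Num.sqrt (u.1 ^+ 2 + u.2 ^+ 2).

Lemma norm2_gt0 u : u != 0 -> 0 < norm2 u.
Proof.
move=> /sqnorm_neq0 u0.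
by rewrite sqrtr_gt0 lt_neqAle eq_sym u0 addr_ge0 // sqr_ge0.
Qed.

(** Lagrange's identity: the square of [det w u] and that of the inner product
    of [w] and [u] add up to the product of the squared lengths. *)
Lemma det_le_edist p q u : `|det (p - q) u| <= Defs.edist p q * norm2 u.
Proof.
rewrite -sqrtr_sqr /Defs.edist /norm2 -sqrtrM ?addr_ge0 ?sqr_ge0 //.
rewrite ler_wsqrtr //.
rewrite -subr_ge0; set e := _ - _.
suff -> : e = ((p - q).1 * u.1 + (p - q).2 * u.2) ^+ 2 by rewrite sqr_ge0.
by rewrite /e /det /=; ring.
Qed.

(** Equality in Lagrange's identity is reached at the orthogonal projection. *)
Lemma foot_on_line p q u : u != 0 ->
  exists2 q', line q u q' & Defs.edist p q' * norm2 u = `|det (p - q) u|.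
Proof.
move=> u0; have uu := sqnorm_neq0 u0.
pose t := ((p - q).1 * u.1 + (p - q).2 * u.2) / (u.1 ^+ 2 + u.2 ^+ 2).
exists (q + t *: u); first by exists t.
rewrite -[RHS]sqrtr_sqr /Defs.edist /norm2 -sqrtrM ?addr_ge0 ?sqr_ge0 //.
congr Num.sqrt.
by rewrite /det /= /GRing.scale /= /t /=; field.
Qed.

Lemma inf_min (A : set R) m : A m -> lbound A m -> inf A = m.
Proof.
move=> Am lAm; apply/eqP; rewrite eq_le; apply/andP; split.
  by apply: ge_inf => //; exists m.
by apply: lb_le_inf => //; exists m.
Qed.

(** The hypothesis on [A] covers both distances in the definition of the
    proximity region: from a point, and from a line parallel to the other
    one. *)
Lemma set_dist_line (A : set (R * R)) q u m : u != 0 -> A !=set0 ->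
  (forall a, A a -> `|det (a - q) u| = m) ->
  set_dist A (line q u) = m / norm2 u.
Proof.
move=> u0 [a Aa] Am; have l0 := norm2_gt0 u0; apply: inf_min.
  have [q' Lq' e] := foot_on_line a q u0.
  exists a => //; exists q' => //.
  by rewrite -(Am _ Aa) -e mulfK // gt_eqF.
move=> _ [b Ab [_ [t _ <-] <-]]; rewrite ler_pdivrMr // -(Am _ Ab).
apply: le_trans (det_le_edist _ _ _).
by rewrite (_ : det (b - (q + t *: u)) u = det (b - q) u) //
   /det /= /GRing.scale /=; ring.
Qed.

Section proximity.
Variables (y : 'I_3 -> R * R) (v : R * R -> 'I_3).
Hypothesis y0 : orient y != 0.

Lemma bary_line k q z : line q (opp_dir y k) z -> bary y k z = bary y k q.
Proof.
move=> [t _ <-]; have D := det_opp_dir y0 k.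
have /(mulfI y0) : orient y * (1 - bary y k (q + t *: opp_dir y k)) =
          orient y * (1 - bary y k q).
  by rewrite -!D /det /= /GRing.scale /=; ring.
lra.
Qed.

(** The prescribed distance leaves two parallels, at levels [r * t] and
    [- r * t] for [t = 1 - bary y (v x) x]; the second one is on the wrong side
    of the vertex, at distance [(r + 1) * t] from the parallel through [x], so
    the strict inequality discards it. *)
Lemma is_ell_rP r x L : 1 <= r -> bary y (v x) x < 1 ->
  is_ell_r y v r x L <-> exists2 q, L = line q (opp_dir y (v x)) &
    1 - bary y (v x) q = r * (1 - bary y (v x) x).
Proof.
move=> r1; rewrite -subr_gt0; set k := v x; set u := opp_dir y k => lx0.
have u0 : u != 0 by exact: opp_dir_neq0.
have l0 := norm2_gt0 u0.
have aD : 0 < `|orient y| by rewrite normr_gt0.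
have dv q : set_dist [set y k] (line q u) =
    `|orient y| * `|1 - bary y k q| / norm2 u.
  apply: set_dist_line => //; first by exists (y k).
  by move=> _ ->; rewrite det_opp_dir // normrM.
have dl q : set_dist (line x u) (line q u) =
    `|orient y| * `|(1 - bary y k q) - (1 - bary y k x)| / norm2 u.
  apply: set_dist_line => //.
    by exists x; exists 0 => //; rewrite scale0r addr0.
  move=> _ [t _ <-]; rewrite -normrM mulrBr -!det_opp_dir //.
  by congr `|_|; rewrite -/u /det /= /GRing.scale /=; ring.
have key q : is_ell_r y v r x (line q u) <->
    1 - bary y k q = r * (1 - bary y k x).
  rewrite /is_ell_r -/k /ell -/k -/u !dv dl.
  rewrite ltr_pM2r ?invr_gt0 // ltr_pM2l // (gtr0_norm lx0).
  have scale A B : `|orient y| * A / norm2 u =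
      r * (`|orient y| * B / norm2 u) <-> A = r * B.
    have c0 : `|orient y| / norm2 u != 0 by rewrite gt_eqF // divr_gt0.
    rewrite [_ * A / _]mulrAC [_ * B / _]mulrAC [r * _]mulrCA.
    by split=> [/(mulfI c0)|->].
  split=> [[_ /scale e lt]|e].
    move: lx0 e lt; set a := 1 - bary y k q; set b := 1 - bary y k x => b0 e lt.
    have [a0|a0] := lerP 0 a; first by rewrite -e ger0_norm.
    by move: lt; rewrite !ltr0_norm //; lra.
  split; first by exists q.
    by apply/scale; rewrite e ger0_norm // mulr_ge0 ?ltW //; lra.
  rewrite e; move: lx0; set b := 1 - bary y k x => b0.
  rewrite !ger0_norm; nra.
split=> [eL|[q -> e]]; last exact/key.
have [[q Lq] _ _] := eL; exists q => //.
by move: eL; rewrite Lq => /key.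
Qed.

(** One inclusion: all vertices of the triangle [w] other than [y (v x)] are on
    the line, so the affine inequality holds at its three vertices. The other
    one: [w] is the image of the whole triangle under the homothety of center
    [y (v x)] and ratio [c], and a point [z] below the level [c] has its
    preimage [z'] in the triangle. *)
Lemma N_PE_real r x z : 1 <= r -> triangle y x -> (forall i, x <> y i) ->
  N_PE y v r%:E x z <->
  triangle y z /\ 1 - bary y (v x) z <= r * (1 - bary y (v x) x).
Proof.
move=> r1 Tx xv; rewrite /N_PE.
case: asboolP => [[i /xv]//|_]; case: asboolP => // _.
have bx : bary y (v x) x < 1.
  rewrite lt_neqAle bary_le1 // andbT; apply/eqP => /(bary_eq1 y0 Tx).
  exact: xv.
split=> [[[L [w [eL [c [b [c0 wE]]] [i [wi Lw] Tw]]]] Tz]|[Tz zx]].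
  split=> //; move: eL => /is_ell_rP-/(_ r1 bx) [q LE e]; rewrite -e.
  have Lb j : L (w j) -> bary y (v x) (w j) = bary y (v x) q.
    by rewrite LE; exact: bary_line.
  (* seen from the opposite edge, the line is not beyond the vertex *)
  have bq : bary y (v x) q <= 1.
    by rewrite -subr_ge0 e mulr_ge0 //; lra.
  rewrite lerD2l lerN2 -subr_ge0.
  pose f z := bary y (v x) z - bary y (v x) q.
  apply: (hull_affine_ge0 (f := f) _ _ Tw); rewrite /f.
    by apply: affineB; [exact: bary_affine|exact: affine_cst].
  elim/(ord3_ind i) => /=.
  - by rewrite wi bary_vertex // eqxx subr_ge0.
  - rewrite Lb ?subrr //; apply: Lw; exact: (hull_vertex _ true).
  - rewrite Lb ?subrr //; apply: Lw; exact: (hull_vertex _ false).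
split=> //; set k := v x in bx zx *; set c := r * _ in zx.
have c0 : 0 < c by rewrite mulr_gt0 ?subr_gt0 //; lra.
pose w j := y k + c *: (y j - y k).
exists (line (w (k + 1)) (opp_dir y k)), w; split.
- apply/is_ell_rP => //; exists (w (k + 1)) => //; rewrite -/c -/k.
  rewrite affine_homothety; last exact: bary_affine.
  by rewrite !bary_vertex // eqxx ord3_neqS /= mulr0n mulr1n; ring.
- exists c, (y k - c *: y k); split=> // i.
  by apply: eq_pair; rewrite /= /GRing.scale /= /GRing.scale /=; ring.
- exists k; split; first by rewrite /w subrr scaler0 addr0.
  move=> _ [a [a0 a1 ->]]; rewrite big_bool in a1; rewrite big_bool /=.
  exists (- (a false * c)) => //.
  have -> : a true = 1 - a false by rewrite -a1 addrK.
  by apply: eq_pair; rewrite /= /GRing.scale /= /GRing.scale /=; ring.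
- pose z' := y k + c^-1 *: (z - y k).
  have zE : z = (1 - c) *: y k + c *: z'.
    apply: eq_pair; rewrite /= /GRing.scale /= /GRing.scale /=; field;
      exact: lt0r_neq0.
  have [a [a0 a1 z'E]] : triangle y z'.
    apply/triangleP => // j; rewrite affine_homothety; last exact: bary_affine.
    move/triangleP: Tz => /(_ y0)-/(_ j) bz; rewrite bary_vertex //.
    have [<-|kj] := eqVneq k j; last first.
      by rewrite mulr0n add0r subr0 mulr_ge0 // invr_ge0 ltW.
    rewrite -(ler_pM2l c0) mulr0 mulr1n mulrDr mulrA divff ?gt_eqF //; lra.
  exists a; split=> //; rewrite zE z'E.
  have -> : (1 - c) *: y k = \sum_j a j *: ((1 - c) *: y k).
    by rewrite -scaler_suml a1 scale1r.
  rewrite scaler_sumr -big_split /=; apply: eq_bigr => j _; rewrite /w.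
  by apply: eq_pair; rewrite /=; do 3 rewrite /GRing.scale /=; ring.
Qed.

End proximity.
End geometry.

(** * Measurability, negligible sets and frequencies *)

Section measure_tools.
Set Implicit Arguments.
Unset Strict Implicit.
Context {d : measure_display} {T : measurableType d} {R : realType}.

Lemma measurable_le_set (f g : T -> R) :
  measurable_fun setT f -> measurable_fun setT g ->
  measurable [set x | f x <= g x].
Proof.
by move=> mf mg; rewrite -[X in measurable X]setTI; exact: measurable_fun_le.
Qed.

Lemma measurable_lt_set (f g : T -> R) :
  measurable_fun setT f -> measurable_fun setT g ->
  measurable [set x | f x < g x].
Proof.
move=> mf mg; rewrite (_ : mkset _ = ~` [set x | g x <= f x]).
  exact/measurableC/measurable_le_set.
by apply/seteqP; split=> x /=; rewrite ltNge => /negP.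
Qed.

Lemma measurable_finforall (I : finType) (F : I -> set T) :
  (forall i, measurable (F i)) -> measurable [set x | forall i, F i x].
Proof.
move=> mF; rewrite (_ : mkset _ = \bigcap_(i in setT) F i); last first.
  by apply/seteqP; split=> x Fx i => [_|]; exact: Fx.
by apply: fin_bigcap_measurable => //; exact: finite_finset.
Qed.

Lemma measurable_finexists (I : finType) (F : I -> set T) :
  (forall i, measurable (F i)) -> measurable [set x | exists i, F i x].
Proof.
move=> mF; rewrite (_ : mkset _ = \bigcup_(i in setT) F i); last first.
  by apply/seteqP; split=> x => [[i Fx]|[i _ Fx]]; exists i.
by apply: fin_bigcup_measurable => //; exact: finite_finset.
Qed.

Lemma measurable_imp_prop (Q : Prop) (A : set T) :
  measurable A -> measurable [set x | Q -> A x].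
Proof.
move=> mA; have [q|nq] := pselect Q.
  by rewrite (_ : mkset _ = A) //; apply/seteqP; split=> x //= /(_ q).
by rewrite (_ : mkset _ = setT) //; apply/seteqP; split=> x // _ /nq.
Qed.

Lemma measurable_and_prop (Q : Prop) (A : set T) :
  measurable A -> measurable [set x | Q /\ A x].
Proof.
move=> mA; have [q|nq] := pselect Q.
  by rewrite (_ : mkset _ = A) //; apply/seteqP; split=> x //= [].
by rewrite (_ : mkset _ = set0) //; apply/seteqP; split=> x // [].
Qed.

Lemma negligible_finexists (mu : {measure set T -> \bar R}) (I : finType)
    (F : I -> set T) :
  (forall i, mu.-negligible (F i)) -> mu.-negligible [set x | exists i, F i x].
Proof.
move=> F0; pose G k := if unpickle k is Some i then F i else set0.
apply: (@negligibleS _ _ _ _ (\bigcup_k G k)).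
  by move=> x [i Fx]; exists (pickle i) => //; rewrite /G pickleK.
apply: negligible_bigcup => k; rewrite /G.
by case: unpickle => // ; exact: negligible_set0.
Qed.

(** Used to replace an event that depends on the values of an arbitrary choice
    function by a Borel one: [N] contains the points at which the choice is
    free. *)
Lemma measure_eq_off_null (mu : {measure set T -> \bar R}) (A B N : set T) :
  measurable A -> measurable B -> measurable N -> mu N = 0%E ->
  (forall x, ~ N x -> A x <-> B x) -> mu A = mu B.
Proof.
move=> mA mB mN N0 AB.
have offN (C : set T) : measurable C -> mu C = mu (C `\` N).
  move=> mC; have CN0 : mu (C `&` N) = 0%E.
    by apply: subset_measure0 N0 => //; exact: measurableI.
  exact: etrans (measureDI mu mC mN) (etrans (congr1 (adde _) CN0) (adde0 _)).
rewrite (offN A mA) (offN B mB); suff -> : A `\` N = B `\` N by [].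
by apply/seteqP; split=> x [Ax nN]; split=> //; apply/AB.
Qed.

Lemma probability_lt_gap (P : probability T R) (A B C : set T) :
  measurable A -> measurable B -> measurable C ->
  A `<=` B -> C `<=` B `\` A -> (0 < P C)%E -> (P A < P B)%E.
Proof.
move=> mA mB mC AB CBA C0.
apply: (@lt_le_trans _ _ (P (A `|` C))).
  rewrite measureU //.
    by rewrite lteDl // fin_num_measure.
  by apply/seteqP; split=> w // [Aw /CBA []].
apply: le_measure; rewrite ?inE //; first exact: measurableU.
by move=> w [/AB|/CBA []].
Qed.

(** Linearity of the expectation: the frequency is an average of indicators. *)
Lemma expectation_frequency (P : probability T R) (I : finType) (S : pred I)
    (E : I -> set T) (p : \bar R) :
  (0 < #|S|)%N -> (forall a, measurable (E a)) ->
  (forall a, S a -> P (E a) = p) ->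
  ('E_P[fun w => (#|[pred a | S a & `[< E a w >]]|%:R / #|S|%:R)%R])%E = p.
Proof.
move=> S0 mE PE; rewrite unlock.
have cE w : (#|[pred a | S a & `[< E a w >]]|%:R / #|S|%:R)%:E =
   ((#|S|%:R^-1)%R%:E * \sum_(a <- enum S) (\1_(E a) w)%R%:E)%E :> \bar R.
  rewrite mulrC EFinM; congr (_ * _)%E.
  rewrite sumEFin; congr EFin.
  rewrite -sum1_card natr_sum big_mkcond /= big_enum /= [RHS]big_mkcond /=.
  apply: eq_bigr => a _; rewrite indicE !inE /= unfold_in.
  by case: (S a) => //=; case: asboolP => Ea; [rewrite mem_set|rewrite memNset].
under eq_integral do rewrite cE.
have m1 a : measurable_fun setT (fun w => (\1_(E a) w)%:E : \bar R).
  by apply/measurable_EFinP; exact: measurable_indic.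
have pE : p \is a fin_num.
  move/card_gt0P : S0 => [a Sa]; rewrite -(PE a Sa); exact: fin_num_measure.
rewrite ge0_integralZl //; last first.
- by move=> w _; apply: sume_ge0 => a _; rewrite lee_fin.
- exact: emeasurable_sum.
rewrite ge0_integral_sum //.
rewrite big_enum /=.
rewrite (eq_bigr (fun=> p)); last first.
  by move=> a Sa; rewrite integral_indic // setIT; exact: PE.
rewrite -(fineK pE) sumEFin -EFinM sumr_const.
rewrite -[fine p *+ _]mulr_natr mulrCA mulVf ?mulr1 //.
by rewrite pnatr_eq0 -lt0n.
Qed.

End measure_tools.

(** * Lebesgue measure of the plane *)

Section plane.
Set Implicit Arguments.
Unset Strict Implicit.
Context {R : realType}.

Lemma affine_measurable (f : R * R -> R) : affine f -> measurable_fun setT f.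
Proof.
move=> [a [b [c fE]]].
have -> : f = fun z => a * z.1 + b * z.2 + c by exact/funext.
apply: measurable_funD => //; apply: measurable_funD.
  by apply: measurable_funM => //; exact: measurable_fst.
by apply: measurable_funM => //; exact: measurable_snd.
Qed.

Lemma affine_continuous (f : R * R -> R) : affine f -> continuous f.
Proof.
move=> [a [b [c fE]]].
have -> : f = fun z => a * z.1 + b * z.2 + c by exact/funext.
move=> z; apply: cvgD; last exact: cvg_cst.
apply: cvgD; apply: cvgM; try exact: cvg_cst.
  exact: cvg_fst.
exact: cvg_snd.
Qed.

Lemma measurable_point (p : R * R) : measurable [set p].
Proof.
rewrite (_ : [set p] = [set p.1] `*` [set p.2]).
  exact: measurableX.
by apply/seteqP; split=> [_ ->|[a b] [/= -> ->]] //; case: p.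
Qed.

Lemma lebesgue2_point (p : R * R) : lebesgue2 [set p] = 0%E.
Proof.
rewrite (_ : [set p] = [set p.1] `*` [set p.2]).
  rewrite /lebesgue2 product_measure1E //= lebesgue_measure_set1.
  exact: mul0e.
by apply/seteqP; split=> [_ ->|[a b] [/= -> ->]] //; case: p.
Qed.

(** A line is null by Fubini's theorem: its sections at fixed first coordinate
    are points, unless it is vertical, in which case it is the product of a
    point and the real line. *)
Lemma affine_null (f : R * R -> R) p q : affine f -> f p != f q ->
  lebesgue2 [set z | f z = 0] = 0%E.
Proof.
move=> [a [b [c fE]]] pq; rewrite /lebesgue2.
have mf0 : measurable [set z | f z = 0].
  have mf : measurable_fun setT f by apply: affine_measurable; exists a, b, c.
  by rewrite -[X in measurable X]setTI; exact: (mf measurableT [set 0]).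
have [b0|b0] := eqVneq b 0; last first.
  apply: integral0_eq => s _ /=.
  apply: (@subset_measure0 _ _ _ lebesgue_measure _
    [set (- (a * s + c)) / b]) => //.
  - exact: measurable_xsection.
  - move=> t; rewrite /xsection /= inE /= fE /= => e.
    apply: (mulfI b0); rewrite mulrCA divff // mulr1; lra.
  - exact: lebesgue_measure_set1.
have a0 : a != 0.
  apply: contraNneq pq => a0; apply/eqP; rewrite !fE b0 a0; ring.
rewrite (_ : mkset _ = [set - c / a] `*` setT).
  by rewrite product_measure1E //= lebesgue_measure_set1 mul0e.
apply/seteqP; split=> [[s t]|[s t] [/= -> _]]; rewrite /= fE /= b0.
  move=> e; split=> //=; apply: (mulfI a0); rewrite mulrCA divff // mulr1; lra.
by rewrite mulrCA divff // mulr1; ring.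
Qed.

(** A neighborhood contains an open square. *)
Lemma nbhs_lebesgue2_gt0 (U : set (R * R)) (p : R * R) :
  measurable U -> nbhs p U -> (0 < lebesgue2 U)%E.
Proof.
move=> mU /nbhs_ballP [e /= e0 eU].
apply: (@lt_le_trans _ _ (lebesgue2 (ball p.1 e `*` ball p.2 e))).
  rewrite /lebesgue2 product_measure1E /=; [|by rewrite ball_itv..].
  rewrite !ball_itv !lebesgue_measure_itv /= !lte_fin !ltrBlDr -!addrA !ltrDl.
  rewrite addr_gt0 // -!EFinB -EFinM lte_fin mulr_gt0 //; lra.
apply: le_measure.
- by rewrite inE !ball_itv; exact: measurableX.
- by rewrite inE.
- by move=> z [z1 z2]; apply: eU; split.
Qed.

End plane.

(** * The arc relation as a Borel relation *)

Section arcs.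
Set Implicit Arguments.
Unset Strict Implicit.
Context {R : realType}.
Variables (y : 'I_3 -> R * R).
Hypothesis y0 : orient y != 0.

Lemma measurable_bary k : measurable_fun setT (bary y k).
Proof. exact: (affine_measurable (bary_affine y k)). Qed.

Lemma triangle_barycentric : triangle y = [set z | forall k, 0 <= bary y k z].
Proof. by apply/seteqP; split=> z /(triangleP y0). Qed.

Lemma measurable_triangle : measurable (triangle y).
Proof.
rewrite triangle_barycentric; apply: measurable_finforall => k.
by apply: measurable_le_set => //; exact: measurable_bary.
Qed.

Definition vertices : set (R * R) := [set x | exists i, x = y i].

Lemma measurable_vertices : measurable vertices.
Proof. by apply: measurable_finexists => i; exact: measurable_point. Qed.

(** The arc relation that results when the region of the [k]-th vertex is
    chosen at [p.1]. It is Borel for each [k], whereas [N_PE] itself depends on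
    [v], about which only the events [v (X i w) = k] are known to be
    measurable. *)
Definition region_arc (r : \bar R) (k : 'I_3) : set ((R * R) * (R * R)) :=
  [set p | (exists i, p.1 = y i /\ p.2 = y i) \/
     [/\ ~ vertices p.1, triangle y p.1, triangle y p.2 &
       r \is a fin_num ->
       1 - bary y k p.2 <= fine r * (1 - bary y k p.1)]].

Lemma N_PE_region_arc v r x z : (1 <= r)%E ->
  N_PE y v r x z <-> region_arc r (v x) (x, z).
Proof.
move=> r1; have [[i xi]|nvx] := pselect (vertices x).
  rewrite /N_PE; case: asboolP => [_|[]]; last by exists i.
  split=> [->|[[j [/= -> ->]] //|[nv]]]; first by left; exists i.
  by exfalso; apply: nv; exists i.
have nv i : x <> y i by move=> xi; apply: nvx; exists i.
have [Tx|nTx] := pselect (triangle y x); last first.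
  rewrite /N_PE; case: asboolP => [[i /nv]//|_]; case: asboolP => // _.
  by split=> // -[[i [/nv]]|[]].
case: r r1 => [r r1| _|//]; last first.
  rewrite /N_PE; case: asboolP => // _; case: asboolP => // _.
  by split=> [Tz|[[i [/nv]]|[]] //]; right.
rewrite N_PE_real //; split=> [[Tz zx]|[[i [/nv]]//|[_ _ Tz /(_ isT) zx]]] //.
by right.
Qed.

Lemma measurable_region_arc r k : measurable (region_arc r k).
Proof.
have mlevel (pr : (R * R) * (R * R) -> R * R) :
    measurable_fun setT pr ->
    measurable_fun setT (fun p => 1 - bary y k (pr p)).
  move=> mpr; apply: measurable_funB => //.
  by apply: measurableT_comp mpr; exact: measurable_bary.
have mT := measurable_triangle; have mV := measurable_vertices.
apply: measurableU.
  apply: measurable_finexists => i.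
  rewrite [X in measurable X](_ : _ = [set y i] `*` [set y i]) //.
  by apply: measurableX; exact: measurable_point.
rewrite [X in measurable X](_ : _ =
    ((~` vertices `&` triangle y) `*` triangle y) `&`
    [set p | r \is a fin_num ->
      1 - bary y k p.2 <= fine r * (1 - bary y k p.1)]); last first.
  by apply/seteqP; split=> [p [? ? ? ?]//|p [[[? ?] ?] ?]]; split.
apply: measurableI.
  by apply: measurableX => //; apply: measurableI => //; exact: measurableC.
apply: measurable_imp_prop.
apply: measurable_le_set; first by apply: mlevel; exact: measurable_snd.
by apply: measurable_funM => //; apply: mlevel; exact: measurable_fst.
Qed.

Definition dominance (k : 'I_3) : set (R * R) :=
  [set x | forall j, j != k -> bary y j x < bary y k x].

Lemma measurable_dominance k : measurable (dominance k).
Proof.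
apply: measurable_finforall => j; apply: measurable_imp_prop.
by apply: measurable_lt_set; exact: measurable_bary.
Qed.

(** Off this set, [v] has no freedom and no point is a degenerate case of the
    definition of [N_PE]. *)
Definition exceptional : set (R * R) :=
  ~` triangle y `|` (vertices `|`
    [set x | exists j k, j != k /\ bary y j x = bary y k x]).

Lemma bary_eqE j k : [set x | bary y j x = bary y k x] =
  [set x | bary y j x - bary y k x = 0].
Proof.
apply/seteqP; split=> x /= /eqP; rewrite ?subr_eq0 => /eqP // ->.
by rewrite subrr.
Qed.

Lemma measurable_bary_eq j k : measurable [set x | bary y j x = bary y k x].
Proof.
have mf : measurable_fun setT (fun x => bary y j x - bary y k x).
  by apply: affine_measurable; apply: affineB; exact: bary_affine.
by rewrite bary_eqE -[X in measurable X]setTI; exact: (mf measurableT [set 0]).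
Qed.

Lemma bary_eq_null j k : j != k ->
  lebesgue2 [set x | bary y j x = bary y k x] = 0%E.
Proof.
move=> jk; have af : affine (fun x => bary y j x - bary y k x).
  by apply: affineB; exact: bary_affine.
rewrite bary_eqE; apply: (@affine_null _ _ (y j) (y k) af).
rewrite /= !bary_vertex // !eqxx (negPf jk) [k == j]eq_sym (negPf jk).
by rewrite mulr1n mulr0n; apply/eqP; lra.
Qed.

Lemma measurable_exceptional : measurable exceptional.
Proof.
apply: measurableU; first by apply: measurableC; exact: measurable_triangle.
apply: measurableU; first exact: measurable_vertices.
apply: measurable_finexists => j; apply: measurable_finexists => k.
by apply: measurable_and_prop; exact: measurable_bary_eq.
Qed.

Lemma region_choice_dominance v x : region_choice y v ->
  ~ exceptional x -> dominance (v x) x /\ forall k, dominance k x -> k = v x.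
Proof.
move=> vc /not_orP[/contrapT Tx /not_orP[nvx neq]].
have Vx := vc x Tx (fun i xi => nvx (ex_intro _ i xi)).
have D : dominance (v x) x.
  move=> j jv; rewrite lt_neqAle vertex_region_bary // andbT.
  by apply/eqP => e; apply: neq; exists j, (v x).
split=> // k Dk; apply/eqP/negP => /negP kv.
have := D _ kv; have := Dk (v x); rewrite eq_sym kv => /(_ isT); lra.
Qed.

(** The arc relation for the choice of the vertex with the largest
    coordinate. *)
Definition dominance_arc r : set ((R * R) * (R * R)) :=
  [set p | exists k, dominance k p.1 /\ region_arc r k p].

Lemma measurable_dominance_arc r : measurable (dominance_arc r).
Proof.
apply: measurable_finexists => k.
apply: measurableI; last exact: measurable_region_arc.
rewrite -[X in measurable X]setTI; apply: measurable_fst => //.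
exact: measurable_dominance.
Qed.

Lemma N_PE_dominance_arc v r x z : region_choice y v -> (1 <= r)%E ->
  ~ exceptional x -> N_PE y v r x z <-> dominance_arc r (x, z).
Proof.
move=> vc r1 nx; rewrite N_PE_region_arc //.
have [Dv vD] := region_choice_dominance vc nx.
by split=> [a|[k [/vD ->]]//]; exists (v x).
Qed.

(** An open strip of the triangle parallel to the edge opposite to [y 0]. *)
Definition slab (s t : R) : set (R * R) :=
  [set z | [/\ s < 1 - bary y 0 z, 1 - bary y 0 z < t,
               0 < bary y 1 z & 0 < bary y (-1) z]].

Lemma measurable_slab s t : measurable (slab s t).
Proof.
have mb := measurable_bary.
have ml : measurable_fun setT (fun z => 1 - bary y 0 z).
  exact: measurable_funB.
rewrite (_ : slab s t =
  ([set z | s < 1 - bary y 0 z] `&` [set z | 1 - bary y 0 z < t]) `&`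
  ([set z | 0 < bary y 1 z] `&` [set z | 0 < bary y (-1) z])); last first.
  by apply/seteqP; split=> z [] // [? ?] [? ?]; split.
by apply: measurableI; apply: measurableI; exact: measurable_lt_set.
Qed.

(** The strip is a neighborhood of its point [p] on the median from [y 0], at
    the middle level. *)
Lemma slab_gt0 s t : 0 <= s -> s < t -> t <= 1 -> (0 < lebesgue2 (slab s t))%E.
Proof.
move=> s0 st t1; pose m := (s + t) / 2.
pose a (k : 'I_3) := if k == 0 then 1 - m else m / 2.
pose p : R * R := \sum_k a k *: y k.
have a1 : \sum_k a k = 1 by rewrite (sum_ord3 0) add0r sub0r /a /=; field.
have bp k : bary y k p = a k.
  rewrite affine_comb //; last exact: bary_affine.
  under eq_bigr do rewrite bary_vertex //.
  rewrite (bigD1 k) //= eqxx mulr1 big1 ?addr0 // => j /negPf->.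
  by rewrite mulr0.
apply: (@nbhs_lebesgue2_gt0 _ _ p); first exact: measurable_slab.
have cb k : bary y k z @[z --> p] --> bary y k p.
  exact: (affine_continuous (bary_affine y k)).
have b0 : bary y 0 p = 1 - m by rewrite bp.
have b1 : bary y 1 p = m / 2 by rewrite bp.
have b2 : bary y (-1) p = m / 2 by rewrite bp.
have lt0 : \forall z \near p, bary y 0 z < 1 - s.
  by apply: (cvgr_lt _ (cb 0)); rewrite b0 /m; lra.
have gt0 : \forall z \near p, 1 - t < bary y 0 z.
  by apply: (cvgr_gt _ (cb 0)); rewrite b0 /m; lra.
have gt1 : \forall z \near p, 0 < bary y 1 z.
  by apply: (cvgr_gt _ (cb 1)); rewrite b1 /m; lra.
have gt2 : \forall z \near p, 0 < bary y (-1) z.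
  by apply: (cvgr_gt _ (cb (-1))); rewrite b2 /m; lra.
near=> z.
have z0 : bary y 0 z < 1 - s by near: z.
have z1 : 1 - t < bary y 0 z by near: z.
by split; [lra|lra|near: z|near: z].
Unshelve. all: by end_near.
Qed.

Lemma slab_triangle s t : t <= 1 -> slab s t `<=` triangle y.
Proof.
move=> t1 z [sz zt z1 z2]; apply/triangleP => // k.
apply: (ord3_ind 0 (fun k => 0 <= bary y k z)); rewrite ?add0r ?sub0r; lra.
Qed.

(** The coordinate at [y 0] exceeds 1/2, so no other one can be larger. *)
Lemma slab_region v s t x : region_choice y v -> t <= 2^-1 ->
  slab s t x -> v x = 0 /\ ~ vertices x.
Proof.
move=> vc t1 Sx; have Tx : triangle y x by apply: slab_triangle Sx; lra.
case: Sx => [sx xt x1 x2].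
have nv : ~ vertices x.
  move=> [i xi]; move: x1 x2; rewrite xi !bary_vertex //.
  by case: i {xi} => -[|[|[|]]] //= ?; rewrite ltxx.
split=> //; apply/eqP/negP => /negP v0.
have Vx := vc x Tx (fun i xi => nv (ex_intro _ i xi)).
have := vertex_region_bary y0 0 Vx.
have := sum_bary y0 0 x; rewrite add0r sub0r.
move/triangleP: Tx => /(_ y0) b0.
elim/(ord3_ind 0): (v x) v0 => //; rewrite ?add0r ?sub0r => _; lra.
Qed.

(** With [s] and [t] the levels of [x] and [z] from the vertex [y 0],
    [t < 1 / (4 * r) <= 1 / 4 < s <= r * s] gives the first arc and
    [r * t < 1 / 4 < s] excludes the second. *)
Lemma slab_arc v r x z : region_choice y v -> 1 <= r ->
  slab 4^-1 2^-1 x -> slab 0 (4 * r)^-1 z ->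
  N_PE y v r%:E x z /\ ~ N_PE y v r%:E z x.
Proof.
move=> vc r1 Sx Sz.
have r4 : (4 * r)^-1 <= 4^-1.
  rewrite lef_pV2 ?posrE //; lra.
have rr : (4 * r)^-1 * r = 4^-1 by field; lra.
have [vx nx] := slab_region vc (lexx _) Sx.
have [vz nz] : v z = 0 /\ ~ vertices z.
  apply: (slab_region vc) Sz; lra.
have Tx : triangle y x by apply: slab_triangle Sx; lra.
have Tz : triangle y z by apply: slab_triangle Sz; lra.
have x_nv i : x <> y i by move=> e; apply: nx; exists i.
have z_nv i : z <> y i by move=> e; apply: nz; exists i.
rewrite !N_PE_real //.
rewrite vx vz; case: Sx Sz => [x1 x2 _ _] [z1 z2 _ _].
split; first by split=> //; nra.
by move=> [_]; nra.
Qed.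

End arcs.

(** * Independent uniform points *)

Section sampling.
Set Implicit Arguments.
Unset Strict Implicit.
Context {R : realType} {d : measure_display} {Omega : measurableType d}.
Variable P : probability Omega R.

(** Otherwise the quotient that defines the probability of the sure event would
    be 0 and not 1: in the extended reals both [0 / 0] and [+oo / +oo] are 0. *)
Lemma uniform_mass (S : set (R * R)) (X : Omega -> R * R) :
  uniform_on P S X -> lebesgue2 S \is a fin_num /\ (0 < lebesgue2 S)%E.
Proof.
move=> /(_ setT measurableT); rewrite preimage_setT probability_setT setTI.
have : (0 <= lebesgue2 S)%E by apply: (measure_ge0 (_ \x _)%E).
case: (lebesgue2 S) => [s s0|_|//]; last first.
  by rewrite invey mule0 => /eqP; rewrite onee_eq0.
have [->|sN0] := eqVneq s 0; first by rewrite mul0e => /eqP; rewrite onee_eq0.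
by split=> //; rewrite lte_fin lt_neqAle eq_sym sN0.
Qed.

Lemma uniform_null (S A : set (R * R)) (X : Omega -> R * R) :
  uniform_on P S X -> measurable A -> lebesgue2 (A `&` S) = 0%E ->
  P (X @^-1` A) = 0%E.
Proof. by move=> uX mA A0; rewrite uX // A0 mul0e. Qed.

Lemma uniform_gt0 (S A : set (R * R)) (X : Omega -> R * R) :
  uniform_on P S X -> measurable A -> A `<=` S -> (0 < lebesgue2 A)%E ->
  (0 < P (X @^-1` A))%E.
Proof.
move=> uX mA AS A0; have [Sfin S0] := uniform_mass uX.
rewrite uX // (_ : A `&` S = A); last exact/setIidPl.
have Soo : lebesgue2 S != +oo%E by move: Sfin; rewrite fin_numE => /andP[].
by apply: mule_gt0 => //; rewrite inve_gt0 // gt_eqF.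
Qed.

Variables (n : nat) (X : 'I_n -> {RV P >-> (R * R)%type}).
Hypothesis X_indep : mutually_independent P X.

Lemma independent_pair i j (A B : set (R * R)) : i != j ->
  measurable A -> measurable B ->
  P [set w | A (X i w) /\ B (X j w)] = (P (X i @^-1` A) * P (X j @^-1` B))%E.
Proof.
move=> ij mA mB.
pose C k := if k == i then A else if k == j then B else setT.
have mC k : measurable (C k) by rewrite /C; case: ifP => // _; case: ifP.
have := X_indep mC; rewrite (bigD1 i) //= (bigD1 j) /=; last by rewrite eq_sym.
rewrite big1 ?mule1; last first.
  move=> k /andP[/negPf ki /negPf kj].
  by rewrite /C ki kj preimage_setT probability_setT.
have [Ci Cj] : C i = A /\ C j = B by rewrite /C !eqxx eq_sym (negPf ij).
rewrite Ci Cj => <-; congr (P _); apply/seteqP; split=> w /=.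
  move=> [Aw Bw] k _; rewrite /C /=; have [->//|ki] := eqVneq k i.
  by have [->|] := eqVneq k j.
by move=> Cw; rewrite -Ci -Cj; split; exact: Cw.
Qed.

Lemma measurable_sample_pair i j (D : set ((R * R) * (R * R))) :
  measurable D -> measurable [set w | D (X i w, X j w)].
Proof.
move=> mD; rewrite -[X in measurable X]setTI.
apply: (measurable_fun_pair (f := X i) (g := X j)) => //;
  exact: measurable_funPT.
Qed.

Variable S : set (R * R).
Hypothesis X_unif : forall i, uniform_on P S (X i).

(** A measure on the product is determined by its values on the rectangles, and
    these do not depend on the pair by independence and equidistribution. *)
Lemma pair_law i j i' j' (D : set ((R * R) * (R * R))) :
  i != j -> i' != j' -> measurable D ->
  P [set w | D (X i w, X j w)] = P [set w | D (X i' w, X j' w)].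
Proof.
move=> ij ij' mD.
have law a b : a != b ->
    (distribution P (X i) \x distribution P (X i))%E D =
    P [set w | D (X a w, X b w)].
  move=> ab.
  have mab : measurable_fun setT (fun w => (X a w, X b w)).
    by apply: measurable_fun_pair; exact: measurable_funPT.
  pose Xab : {RV P >-> ((R * R) * (R * R))%type} := mfun_Sub (mem_set mab).
  rewrite (@product_measure_unique _ _ _ _ _ _ _ (distribution P Xab)) //.
  move=> A B mA mB.
  have eA : P (X i @^-1` A) = P (X a @^-1` A) by rewrite !X_unif.
  have eB : P (X i @^-1` B) = P (X b @^-1` B) by rewrite !X_unif.
  exact: etrans (independent_pair ab mA mB) (esym (congr2 mule eA eB)).
by rewrite -!law.
Qed.

End sampling.

(** * Means of the densities *)

Lemma card_neq_pairs n :
  #|[pred a : 'I_n * 'I_n | a.1 != a.2]| = (n * (n - 1))%N.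
Proof.
rewrite -sum1_card (eq_bigl (fun a : 'I_n * 'I_n => true && (a.1 != a.2))) //.
rewrite -(pair_big_dep xpredT (fun i j => i != j) (fun _ _ => 1%N)) /=.
under eq_bigr => i _ do rewrite sum1_card.
rewrite (eq_bigr (fun=> (n - 1)%N)); first by rewrite sum_nat_const card_ord.
move=> i _; rewrite -[n in RHS]card_ord subn1 -(cardC1 i).
by apply: eq_card => j; rewrite !inE eq_sym.
Qed.

Lemma card_lt_pairs n :
  #|[pred a : 'I_n * 'I_n | (a.1 < a.2)%N]| = 'C(n, 2).
Proof.
rewrite -sum1_card (eq_bigl (fun a : 'I_n * 'I_n => true && (a.1 < a.2)%N)) //.
rewrite -(pair_big_dep xpredT (fun i j : 'I_n => (i < j)%N)
  (fun _ _ => 1%N)) /=.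
rewrite (exchange_big_dep xpredT) //= -bin2_sum big_mkord.
apply: eq_bigr => j _.
by rewrite -(big_ord_widen n (fun=> 1%N) (ltnW (ltn_ord j))) sum1_card card_ord.
Qed.

Section means.
Set Implicit Arguments.
Unset Strict Implicit.
Context {R : realType} (y : 'I_3 -> R * R).
Hypothesis y0 : orient y != 0.
Variable (v : R * R -> 'I_3).
Hypothesis v_choice : region_choice y v.
Context {d : measure_display} {Omega : measurableType d}.
Context (P : probability Omega R) {n : nat} (n_ge2 : (2 <= n)%N).
Context (X : 'I_n -> {RV P >-> (R * R)%type}).
Hypothesis X_unif : forall i, uniform_on P (triangle y) (X i).
Hypothesis X_indep : mutually_independent P X.
Hypothesis v_meas : forall i k, measurable [set w : Omega | v (X i w) = k].

Lemma exceptional_null i : P (X i @^-1` exceptional y) = 0%E.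
Proof.
have mT := measurable_triangle y0.
have null A : measurable A -> lebesgue2 A = 0%E -> P.-negligible (X i @^-1` A).
  move=> mA A0; apply/negligibleP; first exact: measurable_funPTI.
  apply: (uniform_null (X_unif i)) => //.
  apply: (@subset_measure0 _ _ _ (lebesgue_measure \x lebesgue_measure)%E _ A)
    => //.
  exact: measurableI.
apply: measure_negligible.
  by apply: measurable_funPTI; exact: measurable_exceptional.
apply: negligibleU; last apply: negligibleU.
- apply/negligibleP; first by apply: measurable_funPTI; exact: measurableC.
  apply: (uniform_null (X_unif i)); first exact: measurableC.
  by rewrite setICl /lebesgue2 measure0.
- apply: negligible_finexists => j.
  by apply: (null [set y j]); [exact: measurable_point|exact: lebesgue2_point].
- apply: negligible_finexists => j; apply: negligible_finexists => k.
  have [->|jk] := eqVneq j k.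
    apply: (@negligibleS _ _ _ _ set0); last exact: negligible_set0.
    by move=> w [].
  have E0 := bary_eq_null y0 jk.
  by apply: (negligibleS _ (null _ (measurable_bary_eq y j k) E0)) => w [].
Qed.

Lemma exceptional_pair_null i j :
  measurable (X i @^-1` exceptional y `|` X j @^-1` exceptional y) /\
  P (X i @^-1` exceptional y `|` X j @^-1` exceptional y) = 0%E.
Proof.
have mX c : measurable (X c @^-1` exceptional y).
  by apply: measurable_funPTI; exact: measurable_exceptional.
have mU := measurableU _ _ (mX i) (mX j); split=> //.
apply: measure_negligible => //.
by apply: negligibleU; apply/negligibleP => //; exact: exceptional_null.
Qed.

Definition arc_event r i j : set Omega := [set w | N_PE y v r (X i w) (X j w)].

Lemma measurable_arc_event r i j : (1 <= r)%E -> measurable (arc_event r i j).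
Proof.
move=> r1; rewrite (_ : arc_event r i j = [set w | exists k, v (X i w) = k /\
    region_arc y r k (X i w, X j w)]); last first.
  apply/seteqP; split=> w; rewrite /arc_event /= N_PE_region_arc //.
    by move=> a; exists (v (X i w)).
  by move=> [k [->]].
apply: measurable_finexists => k; apply: measurableI; first exact: v_meas.
exact: (measurable_sample_pair X i j (measurable_region_arc y0 r k)).
Qed.

(** The pattern [F] is a Boolean combination of the two arcs between a pair of
    points; its measurability is asked in all measurable spaces because it is
    used both for events and for Borel relations. *)
Lemma arc_pattern_law r (F : Prop -> Prop -> Prop) i j i' j' :
  (1 <= r)%E ->
  (forall d' (T : measurableType d') (A B : set T),
     measurable A -> measurable B -> measurable [set p | F (A p) (B p)]) ->
  i != j -> i' != j' ->
  P [set w | F (arc_event r i j w) (arc_event r j i w)] =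
  P [set w | F (arc_event r i' j' w) (arc_event r j' i' w)].
Proof.
move=> r1 mF ij ij'.
pose D := [set p | F (dominance_arc y r p) (dominance_arc y r (p.2, p.1))].
have mC := measurable_dominance_arc y0 r.
have mswap : measurable
    [set p : (R * R) * (R * R) | dominance_arc y r (p.2, p.1)].
  have ms : measurable_fun setT (fun p : (R * R) * (R * R) => (p.2, p.1)).
    apply: measurable_fun_pair; first exact: measurable_snd.
    exact: measurable_fst.
  by rewrite -[X in measurable X]setTI; exact: (ms measurableT _ mC).
have mD : measurable D by exact: mF.
suff E a b : a != b -> P [set w | F (arc_event r a b w) (arc_event r b a w)] =
    P [set w | D (X a w, X b w)].
  by rewrite !E // (pair_law X_indep X_unif ij ij').
move=> ab; have [mN N0] := exceptional_pair_null a b.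
apply: measure_eq_off_null mN N0 _.
- by apply: mF; exact: measurable_arc_event.
- exact: measurable_sample_pair.
- move=> w /not_orP[na nb]; rewrite /D /= /arc_event /=.
  rewrite (propext (N_PE_dominance_arc y0 _ v_choice r1 na)).
  by rewrite (propext (N_PE_dominance_arc y0 _ v_choice r1 nb)).
Qed.

Lemma mean_arcs r i j : (1 <= r)%E -> i != j ->
  p_arc P y v X r = P (arc_event r i j).
Proof.
move=> r1 ij; pose S := [pred a : 'I_n * 'I_n | a.1 != a.2].
have S0 : (0 < #|S|)%N by apply/card_gt0P; exists (i, j).
pose E (a : 'I_n * 'I_n) := arc_event r a.1 a.2.
rewrite -[RHS](@expectation_frequency _ _ _ P _ S E _ S0).
- rewrite /p_arc /arc_density -card_neq_pairs; congr ('E_P[_])%E.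
- by move=> a; exact: measurable_arc_event.
- move=> a aS.
  by apply: (@arc_pattern_law r (fun A _ => A)) => // d' T A B mA _.
Qed.

Lemma mean_edges r (G : rel 'I_n -> rel 'I_n) (F : Prop -> Prop -> Prop) i j :
  (1 <= r)%E ->
  (forall d' (T : measurableType d') (A B : set T),
     measurable A -> measurable B -> measurable [set p | F (A p) (B p)]) ->
  (forall e k l, G e k l <-> F (e k l) (e l k)) ->
  i != j ->
  ('E_P[fun w => edge_density (G (pe_pcd y v X r w))] =
  P [set w | F (arc_event r i j w) (arc_event r j i w)])%E.
Proof.
move=> r1 mF GF ij; pose S := [pred a : 'I_n * 'I_n | (a.1 < a.2)%N].
have S0 : (0 < #|S|)%N by rewrite card_lt_pairs bin_gt0.
pose E (a : 'I_n * 'I_n) :=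
  [set w | F (arc_event r a.1 a.2 w) (arc_event r a.2 a.1 w)].
rewrite -[RHS](@expectation_frequency _ _ _ P _ S E _ S0).
- rewrite /edge_density -card_lt_pairs; congr ('E_P[_])%E; apply/funext => w.
  congr (_%:R / _); apply: eq_card => a; rewrite !inE /S /=.
  have [lt|//] := ltnP a.1 a.2.
  have ne : a.1 != a.2 by rewrite -val_eqE neq_ltn lt.
  have arcE k l : k != l -> pe_pcd y v X r w k l = arc_event r k l w :> Prop.
    by move=> kl; rewrite /pe_pcd /pcd_arc kl asboolE.
  apply/idP/asboolP => [/GF|]; rewrite /E /= -!arcE // 1?eq_sym //.
  by move/GF.
- by move=> a; apply: mF; exact: measurable_arc_event.
- move=> a aS; apply: arc_pattern_law => //.
  by move: aS; rewrite /S /= -val_eqE neq_ltn => ->.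
Qed.

(** * Strictness and the infinite parameter *)

Lemma slab_pair_gt0 r i j : i != j -> 1 <= r ->
  (0 < P [set w | slab y 4^-1 2^-1 (X i w) /\ slab y 0 (4 * r)^-1 (X j w)])%E.
Proof.
move=> ij r1.
have r4 : (4 * r)^-1 <= 1 by rewrite invf_le1; lra.
rewrite independent_pair //; [|exact: measurable_slab..].
apply: mule_gt0; apply: (uniform_gt0 (X_unif _)).
- exact: measurable_slab.
- apply: slab_triangle => //; lra.
- by apply: slab_gt0 => //; lra.
- exact: measurable_slab.
- exact: slab_triangle.
- by apply: slab_gt0 => //; rewrite invr_gt0; lra.
Qed.

Lemma Gamma1E r x z : Gamma1 y v r x z <-> N_PE y v r z x.
Proof.
split=> [[]//|Nzx]; split=> //; move: Nzx; rewrite /N_PE.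
case: asboolP => [[i ->] _|_]; first exact: hull_vertex.
by case: asboolP.
Qed.

Lemma arc_event_pinfty i j w : ~ exceptional y (X i w) ->
  ~ exceptional y (X j w) -> arc_event +oo%E i j w.
Proof.
move=> /not_orP[/contrapT Ti /not_orP[nvi _]] /not_orP[/contrapT Tj _].
apply/N_PE_region_arc => //; first exact: leey.
by right; split=> //; left.
Qed.

Lemma probability1_off_exceptional (A : set Omega) i j : measurable A ->
  (forall w, ~ exceptional y (X i w) -> ~ exceptional y (X j w) -> A w) ->
  P A = 1%E.
Proof.
move=> mA Aw; rewrite -(probability_setT P).
have [mN N0] := exceptional_pair_null i j.
apply: measure_eq_off_null mN N0 _ => // w /not_orP[ni nj].
by split=> // _; exact: Aw.
Qed.

End means.

Theorem lemma4p3 (R : realType) (y : 'I_3 -> R * R) (y_nc : ~ collinear y)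
    (v : R * R -> 'I_3) (v_choice : region_choice y v)
    (d : measure_display) (Omega : measurableType d) (P : probability Omega R)
    (n : nat) (n_ge2 : (2 <= n)%N) (X : 'I_n -> {RV P >-> (R * R)%type})
    (X_unif : forall i, uniform_on P (triangle y) (X i))
    (X_indep : mutually_independent P X)
    (v_meas : forall i k, measurable [set w : Omega | v (X i w) = k]) :
  [/\ forall (r : \bar R) (i j : 'I_n), (1 <= r)%E -> i != j ->
        [/\ p_and P y v X r =
              P [set w | (N_PE y v r (X i w) `&` Gamma1 y v r (X i w)) (X j w)],
            p_arc P y v X r = P [set w | N_PE y v r (X i w) (X j w)] &
            p_or P y v X r =
              P [set w | (N_PE y v r (X i w) `|` Gamma1 y v r (X i w)) (X j w)]],
      forall r : R, 1 <= r ->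
        (p_and P y v X r%:E < p_arc P y v X r%:E < p_or P y v X r%:E)%E &
      [/\ p_and P y v X +oo%E = 1%E, p_arc P y v X +oo%E = 1%E &
          p_or P y v X +oo%E = 1%E]].
Proof.
have y0 := noncollinear_orient y_nc.
have mArc r i j (r1 : (1 <= r)%E) := measurable_arc_event y0 v_meas i j r1.
have and_mean r i j : (1 <= r)%E -> i != j -> p_and P y v X r =
    P [set w | arc_event y v X r i j w /\ arc_event y v X r j i w].
  move=> r1 ij; apply: (mean_edges y0 v_choice n_ge2 X_unif X_indep v_meas
    (F := and)) => //; first by move=> d' T A B mA mB; exact: measurableI.
  by move=> e k l; split=> /andP.
have or_mean r i j : (1 <= r)%E -> i != j -> p_or P y v X r =
    P [set w | arc_event y v X r i j w \/ arc_event y v X r j i w].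
  move=> r1 ij; apply: (mean_edges y0 v_choice n_ge2 X_unif X_indep v_meas
    (F := or)) => //; first by move=> d' T A B mA mB; exact: measurableU.
  by move=> e k l; split=> /orP.
have arc_mean r i j : (1 <= r)%E -> i != j ->
    p_arc P y v X r = P (arc_event y v X r i j).
  exact: (mean_arcs y0 v_choice X_unif X_indep v_meas).
pose i0 : 'I_n := Ordinal (ltnW n_ge2); pose i1 : 'I_n := Ordinal n_ge2.
have i01 : i0 != i1 by [].
split=> [r i j r1 ij|r r1|].
- rewrite (and_mean r i j) // (arc_mean r i j) // (or_mean r i j) //.
  split=> //; congr (P _); apply/seteqP.
    by split=> w [a] /Gamma1E.
  by split=> w [a|/Gamma1E]; by [left|right].
- have r1' : (1 <= r%:E)%E by rewrite lee_fin.
  rewrite (and_mean _ i0 i1) // (arc_mean _ i0 i1) // (or_mean _ i0 i1) //.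
  have slabs i j : measurable
      [set w | slab y 4^-1 2^-1 (X i w) /\ slab y 0 (4 * r)^-1 (X j w)].
    by apply: measurableI; apply: measurable_funPTI; exact: measurable_slab.
  have gap i j w : slab y 4^-1 2^-1 (X i w) /\ slab y 0 (4 * r)^-1 (X j w) ->
      arc_event y v X r%:E i j w /\ ~ arc_event y v X r%:E j i w.
    by move=> [Sx Sz]; exact: slab_arc.
  apply/andP; split.
  + apply: probability_lt_gap (slab_pair_gt0 y0 X_unif X_indep i01 r1).
    * apply: measurableI; exact: mArc.
    * exact: mArc.
    * exact: slabs.
    * by move=> w [].
    * by move=> w /gap[a01 na10]; split=> // -[].
  (* the arc from i1 to i0 is the unreciprocated one here *)
  + have i10 : i1 != i0 by [].
    apply: probability_lt_gap (slab_pair_gt0 y0 X_unif X_indep i10 r1).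
    * exact: mArc.
    * apply: measurableU; exact: mArc.
    * exact: slabs.
    * by move=> w a01; left.
    * by move=> w /gap[a10 na01]; split=> //; right.
- have ooge1 : (1 <= +oo :> \bar R)%E by exact: leey.
  rewrite (and_mean _ i0 i1) // (arc_mean _ i0 i1) // (or_mean _ i0 i1) //.
  split; apply: (probability1_off_exceptional y0 X_unif (i := i0) (j := i1)).
  + apply: measurableI; exact: mArc.
  + by move=> w n0 n1; split; exact: arc_event_pinfty.
  + exact: mArc.
  + by move=> w n0 n1; exact: arc_event_pinfty.
  + apply: measurableU; exact: mArc.
  + by move=> w n0 n1; left; exact: arc_event_pinfty.
Qed.
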